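(* Let $p$ be a prime, $\Bbbk$ a field of characteristic $p$, $G=\langle\sigma\rangle$ a cyclic group of order $p$, $1\le n\le p$, $V=V_2$ and $W=V_n$. Then the module of covariants $\Bbbk[V,W]^G$ is generated freely over $\Bbbk[V]^G$ by $$\{\Theta(x_1^k): k=0,\ldots,n-1\},$$ where $\Theta(x_1^0)=\Theta(1)=w_1$.
   Context: $V_i$ denotes the indecomposable $\Bbbk G$-module of dimension $i$ ($1\le i\le p$), on which $\sigma$ acts by a single unipotent Jordan block of size $i$. $\Bbbk[V]=S(V^* )$ and $\Bbbk[V,W]=S(V^* )\otimes W$ with diagonal $G$-action; $\Bbbk[V]^G$ is the ring of invariants and $\Bbbk[V,W]^G=(S(V^* )\otimes W)^G$ is the $\Bbbk[V]^G$-module of covariants. For $V=V_2$, $\Bbbk[V]=\Bbbk[x_1,x_2]$ with $\sigma x_1=x_1+x_2$, $\sigma x_2=x_2$. $W=V_n$ has basis $w_1,\ldots,w_n$ with $\sigma w_i=w_i-w_{i-1}+w_{i-2}-\cdots\pm w_1$ for all $i$. Let $\Delta=\sigma-1$ acting on $\Bbbk[V]$, and $K_n=\{f\in\Bbbk[V]:\Delta^n(f)=0\}$. The map $\Theta:K_n\to\Bbbk[V,W]^G$ is defined by $\Theta(f)=\sum_{i=1}^n\Delta^{i-1}(f)\,w_i$. *)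

(* Defs.v *)
From HB Require Import structures.
From mathcomp Require Import all_boot all_order all_algebra all_fingroup.
From mathcomp Require Import all_character.
From mathcomp Require Import mpoly.

Set Implicit Arguments.
Unset Strict Implicit.
Unset Printing Implicit Defensive.

Import GRing.Theory.
Local Open Scope ring_scope.

Section Covariants.

Variables (K : fieldType) (gT : finGroupType) (G : {group gT}) (m n : nat).

(* [rX] is the matrix representation of G on V^* in a basis x_0, .., x_(m-1),
   and [rW] the one on W in a basis w_0, .., w_(n-1).  Representations act on
   row vectors: row i of the matrix of g lists the coordinates of the image
   of the i-th basis vector under g. *)
Variables (rX : mx_representation K G m) (rW : mx_representation K G n).

(* S(V^* ) is {mpoly K[m]}; g acts as the algebra endomorphism extending its
   action on the variables. *)
Definition actS (g : gT) (f : {mpoly K[m]}) : {mpoly K[m]} :=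
  f \mPo [tuple \sum_(j < m) rX g i j *: 'X_j | i < m].

(* S(V^* ) (x) W is free over S(V^* ) on the w_i, so the row vector u stands
   for \sum_i u_i (x) w_i; the diagonal action sends it to
   \sum_i g(u_i) (x) g(w_i). *)
Definition actSW (g : gT) (u : 'rV[{mpoly K[m]}]_n) : 'rV[{mpoly K[m]}]_n :=
  map_mx (actS g) u *m map_mx (@mpolyC m K) (rW g).

Definition invariants : {pred {mpoly K[m]}} :=
  [pred f | [forall g in G, actS g f == f]].

Definition covariants : {pred 'rV[{mpoly K[m]}]_n} :=
  [pred u | [forall g in G, actSW g u == u]].

Lemma invariants_subring : subring_closed invariants.
Proof.
split=> [|f h|f h].
- by apply/forall_inP=> g Gg; rewrite /actS rmorph1.
- move=> /forall_inP fG /forall_inP hG; apply/forall_inP=> g Gg.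
  by rewrite /actS rmorphB /= -!/(actS g _) (eqP (fG g Gg)) (eqP (hG g Gg)).
- move=> /forall_inP fG /forall_inP hG; apply/forall_inP=> g Gg.
  by rewrite /actS rmorphM /= -!/(actS g _) (eqP (fG g Gg)) (eqP (hG g Gg)).
Qed.

HB.instance Definition _ :=
  GRing.isSubringClosed.Build {mpoly K[m]} invariants invariants_subring.

Lemma covariants_zmod : zmod_closed covariants.
Proof.
split=> [|u v].
  apply/forall_inP=> g Gg; apply/eqP.
  rewrite /actSW (_ : map_mx _ 0 = 0) ?mul0mx //.
  by apply/matrixP=> i j; rewrite !mxE /actS rmorph0.
move=> /forall_inP uG /forall_inP vG; apply/forall_inP=> g Gg; apply/eqP.
rewrite -[in RHS](eqP (uG g Gg)) -[in RHS](eqP (vG g Gg)) /actSW -mulmxBl.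
by congr (_ *m _); apply/matrixP=> i j; rewrite !mxE /actS rmorphB.
Qed.

HB.instance Definition _ :=
  GRing.isZmodClosed.Build 'rV[{mpoly K[m]}]_n covariants covariants_zmod.

Lemma covariantsZ (a : {mpoly K[m]}) (u : 'rV[{mpoly K[m]}]_n) :
  a \in invariants -> u \in covariants -> a *: u \in covariants.
Proof.
move=> /forall_inP aG /forall_inP uG; apply/forall_inP=> g Gg; apply/eqP.
rewrite -[in RHS](eqP (uG g Gg)) -[in RHS](eqP (aG g Gg)) /actSW scalemxAl.
by congr (_ *m _); apply/matrixP=> i j; rewrite !mxE /actS rmorphM.
Qed.

Variable sigma : gT.

Definition Delta (f : {mpoly K[m]}) : {mpoly K[m]} := actS sigma f - f.

Definition kerDelta (r : nat) : {pred {mpoly K[m]}} :=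
  [pred f | iter r Delta f == 0].

Definition wbasis (i : 'I_n) : 'rV[{mpoly K[m]}]_n := delta_mx 0 i.

(* With 0-based indices the coefficient of w_i is Delta^i f.  The definition
   is total, but is only meaningful for f in [kerDelta n]. *)
Definition Theta (f : {mpoly K[m]}) : 'rV[{mpoly K[m]}]_n :=
  \sum_(i < n) iter i Delta f *: wbasis i.

End Covariants.

(* The family b is a basis of N as a module over the subring A of S, where N
   is an A-submodule of the S-module M. *)
Definition freely_generates (S : comNzRingType) (M : lmodType S)
    (A : {pred S}) (N : {pred M}) (r : nat) (b : 'I_r -> M) : Prop :=
  [/\ forall k, b k \in N,
      forall u, u \in N -> exists2 c : 'I_r -> S,
        (forall k, c k \in A) & u = \sum_(k < r) c k *: b k
    & forall c : 'I_r -> S, (forall k, c k \in A) ->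
        \sum_(k < r) c k *: b k = 0 -> forall k, c k = 0].

(* sigma x_0 = x_0 + x_1 and sigma x_1 = x_1. *)
Definition sigmaX_mx (K : fieldType) : 'M[K]_2 :=
  \matrix_(i < 2, j < 2) (i <= j)%:R.

(* sigma w_i = w_i - w_(i-1) + w_(i-2) - .. , ending with w_0. *)
Definition sigmaW_mx (K : fieldType) (n : nat) : 'M[K]_n :=
  \matrix_(i < n, j < n) (if (j <= i)%N then (-1) ^+ (i - j) else 0).

(* Main.v *)
(* Invariance of u = sum_i u_i w_i under sigma amounts to u_(i+1) = Delta u_i
   and Delta u_n = 0, so Theta is an isomorphism from K_n = ker Delta^n onto
   the covariants.  Over the invariants, K_n is free on 1, x1, .., x1^(n-1):
   Delta is linear over the invariants and Delta^k x1^k = k! x2^k is killed by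
   Delta, which gives freeness by a triangularity argument.  Conversely, x2
   divides every Delta f, hence x2^(n-1) divides Delta^(n-1) f; for f in K_n
   the quotient by (n-1)! x2^(n-1) is an invariant a, and f - a x1^(n-1) lies
   in K_(n-1). *)

From HB Require Import structures.
Require Import Defs.
From mathcomp Require Import all_boot all_order all_algebra all_fingroup.
From mathcomp Require Import all_character.
From mathcomp Require Import ring.
From mathcomp Require Import mpoly.

Set Implicit Arguments.
Unset Strict Implicit.
Unset Printing Implicit Defensive.

Import GRing.Theory.
Local Open Scope ring_scope.

(** * The difference operator [s - 1] on a domain *)

Section Difference.

Variables (S : idomainType) (s : {rmorphism S -> S}).

Definition diff (f : S) : S := s f - f.

Lemma diff0 : diff 0 = 0.
Proof. by rewrite /diff rmorph0 subrr. Qed.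

Lemma iter_diff0 k : iter k diff 0 = 0.
Proof. by elim: k => //= k ->; rewrite diff0. Qed.

Lemma diffB f g : diff (f - g) = diff f - diff g.
Proof. by rewrite /diff rmorphB; ring. Qed.

Lemma diff_eq0 f : diff f = 0 <-> s f = f.
Proof. by split=> [/subr0_eq | sf]; rewrite /diff ?sf ?subrr. Qed.

Lemma diffM a f : s a = a -> diff (a * f) = a * diff f.
Proof. by move=> sa; rewrite /diff rmorphM sa mulrBr. Qed.

Lemma iter_diffB k f g :
  iter k diff (f - g) = iter k diff f - iter k diff g.
Proof. by elim: k => //= k ->; rewrite diffB. Qed.

Lemma iter_diffD k f g :
  iter k diff (f + g) = iter k diff f + iter k diff g.
Proof.
by elim: k => //= k ->; rewrite /diff rmorphD; ring.
Qed.

Lemma iter_diff_sum k n (F : 'I_n -> S) :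
  iter k diff (\sum_i F i) = \sum_i iter k diff (F i).
Proof.
apply: (big_morph (iter k diff) (iter_diffD k)); exact: iter_diff0.
Qed.

Lemma iter_diffM k a f : s a = a -> iter k diff (a * f) = a * iter k diff f.
Proof. by move=> sa; elim: k => //= k ->; rewrite diffM. Qed.

Variables x y : S.
Hypotheses (sx : s x = x + y) (sy : s y = y).

(** This iterates the twisted Leibniz rule [diff (x * f) = x * diff f + y * s f] with
    [s f = f + diff f]; as [s] fixes [y], each further application adds one more copy of the [y]
    term. *)
Lemma iter_diff_mulx k f :
  iter k.+1 diff (x * f) =
  x * iter k.+1 diff f + k.+1%:R * y * (iter k diff f + iter k.+1 diff f).
Proof.
elim: k => [|k IH]; first by rewrite /= /diff rmorphM sx; ring.
rewrite iterS {}IH !iterS; set g := iter k diff f.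
rewrite /diff !(rmorphD, rmorphB, rmorphM, rmorph_nat) /= sx sy.
by rewrite -[k.+2]addn1 -[k.+1]addn1 !natrD; ring.
Qed.

Lemma iter_diff_expx k :
  iter k diff (x ^+ k) = k`!%:R * y ^+ k /\ iter k.+1 diff (x ^+ k) = 0.
Proof.
elim: k => [|k [IH IH0]].
  by split; rewrite /= ?mulr1 // /diff expr0 rmorph1 subrr.
split; rewrite exprS iter_diff_mulx.
  by rewrite IH IH0 factS natrM exprS; ring.
by rewrite [iter k.+2 _ _]iterS IH0 diff0; ring.
Qed.

Lemma iter_diff_expx_lt k j : (k < j)%N -> iter j diff (x ^+ k) = 0.
Proof.
move=> /subnK <-.
by rewrite iterD (iter_diff_expx k).2 iter_diff0.
Qed.

Lemma iter_diff_sum_expx r (c : 'I_r.+1 -> S) :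
  (forall k, s (c k) = c k) ->
  iter r diff (\sum_(k < r.+1) c k * x ^+ k) = c ord_max * (r`!%:R * y ^+ r).
Proof.
move=> sc; rewrite iter_diff_sum big_ord_recr big1 /= => [|i _].
  by rewrite add0r iter_diffM ?(iter_diff_expx r).1.
by rewrite iter_diffM // iter_diff_expx_lt ?mulr0 /=.
Qed.

Lemma expx_free r (c : 'I_r -> S) :
  y != 0 -> (forall k : 'I_r, (k`!)%:R != 0 :> S) ->
  (forall k, s (c k) = c k) ->
  \sum_(k < r) c k * x ^+ k = 0 -> forall k, c k = 0.
Proof.
move=> y0; elim: r c => [c _ _ _ []//|r IH c fact_neq0 sc c0].
have cmax0 : c ord_max = 0.
  have := iter_diff_sum_expx sc; rewrite c0 iter_diff0 => /esym/eqP.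
  rewrite mulf_eq0 mulf_eq0 (negPf (fact_neq0 ord_max)) /=.
  by rewrite expf_eq0 (negPf y0) andbF orbF => /eqP.
move=> k; case: (unliftP ord_max k) => [j ->|-> //].
rewrite (_ : lift _ _ = widen_ord (leqnSn r) j); last first.
  by apply: val_inj; rewrite /= /bump leqNgt ltn_ord.
apply: (IH (fun k => c (widen_ord (leqnSn r) k))) => [i|i|].
- exact: (fact_neq0 (widen_ord (leqnSn r) i)).
- exact: sc.
- by move: c0; rewrite big_ord_recr /= cmax0 mul0r addr0.
Qed.

Hypothesis diff_dvd : forall f, exists g, diff f = y * g.

(** Powers of [y] are fixed by [s], so [diff] passes through them and each application gains one
    factor [y]. *)
Lemma iter_diff_dvd k f : exists g, iter k diff f = y ^+ k * g.
Proof.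
elim: k => [|k [g IH]]; first by exists f; rewrite mul1r.
have [h gh] := diff_dvd g; exists h.
by rewrite iterS IH diffM ?rmorphXn ?sy // gh exprSr mulrA.
Qed.

Lemma expx_generates r f :
  y != 0 -> (forall k : 'I_r, (k`!)%:R \is a @GRing.unit S) ->
  iter r diff f = 0 ->
  exists2 c : 'I_r -> S, forall k, s (c k) = c k
    & f = \sum_(k < r) c k * x ^+ k.
Proof.
move=> y0; elim: r f => [|r IH] f fact_unit f0.
  by exists (fun=> 0) => [[]//|]; rewrite big_ord0.
have [g fg] := iter_diff_dvd r f.
have fact_r : r`!%:R \is a @GRing.unit S := fact_unit ord_max.
(* Here [y ^+ r * diff g = diff (y ^+ r * g)] is the (r+1)-st difference of [f], which is zero. *)
have sg : s g = g.
  apply/diff_eq0; apply: (mulfI (expf_neq0 r y0)).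
  by rewrite mulr0 -diffM ?rmorphXn ?sy // -fg.
have sa : s (g / r`!%:R) = g / r`!%:R.
  by rewrite rmorphM rmorphV // rmorph_nat sg.
(* With this [a], the r-th differences of [a * x ^+ r] and of [f] agree. *)
set a := g / _ in sa.
have [||c sc fc] := IH (f - a * x ^+ r).
- by move=> k; apply: (fact_unit (widen_ord (leqnSn r) k)).
- rewrite iter_diffB iter_diffM // (iter_diff_expx r).1 fg.
  by rewrite /a mulrA divrK // mulrC subrr.
(* The family [c] below the top index, extended by [a] at the top. *)
exists (fun k => oapp c a (unlift ord_max k)) => [k|].
  by case: (unlift _ _).
rewrite big_ord_recr /= unlift_none /= -[LHS](subrK (a * x ^+ r)) fc.
congr (_ + _); apply: eq_bigr => i _.
rewrite (_ : widen_ord _ i = lift ord_max i) ?liftK //.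
by apply: val_inj; rewrite /= /bump leqNgt ltn_ord.
Qed.

End Difference.

(** * Substitution in polynomials *)

Lemma comp_mpolyA (R : comNzRingType) (k l m : nat) (f : {mpoly R[k]})
    (t : k.-tuple {mpoly R[l]}) (u : l.-tuple {mpoly R[m]}) :
  (f \mPo t) \mPo u = f \mPo [tuple tnth t i \mPo u | i < k].
Proof.
elim/mpolyind: f => [|c v f _ _ IH]; first by rewrite !comp_mpoly0.
rewrite !comp_mpolyD !comp_mpolyZ IH !comp_mpolyX rmorph_prod.
congr (_ *: _ + _); apply: eq_bigr => i _.
by rewrite rmorphXn /= tnth_mktuple.
Qed.

(** Being fixed modulo [y] is stable under products and linear combinations, so it need only be
    tested on the variables. *)
Lemma comp_mpoly_sub_dvd (R : comNzRingType) (m : nat)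
    (t : m.-tuple {mpoly R[m]}) (y : {mpoly R[m]}) :
  (forall i, exists g, tnth t i - 'X_i = y * g) ->
  forall f, exists g, (f \mPo t) - f = y * g.
Proof.
move=> t_dvd; pose P f := exists g, (f \mPo t) - f = y * g.
have P1 : P 1 by exists 0; rewrite comp_mpoly1 subrr mulr0.
have PM a b : P a -> P b -> P (a * b).
  (* Expand [(a + y * g) * (b + y * h) - a * b] and take out [y]. *)
  move=> [g ag] [h bh]; exists (a * h + g * b + y * g * h).
  rewrite rmorphM /= -(subrK a (a \mPo t)) -(subrK b (b \mPo t)) ag bh; ring.
elim/mpolyind => [|c v f _ _ [g fg]].
  by exists 0; rewrite comp_mpoly0 subrr mulr0.
have [h vh] : P 'X_[v].
  rewrite mpolyXE_id; apply: big_ind => // i _.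
  elim: (v i) => [|k IH]; rewrite ?expr0 ?exprS //; apply: PM => //.
  by have [g' tg] := t_dvd i; exists g'; rewrite comp_mpolyXU -tnth_nth.
exists (c *: h + g).
rewrite comp_mpolyD comp_mpolyZ opprD addrACA -scalerBr vh fg.
by rewrite mulrDr scalerAr.
Qed.

(** * The matrix of sigma on W and its bidiagonal inverse *)

Definition bidiag_mx (R : nzRingType) (n : nat) : 'M[R]_n :=
  \matrix_(i < n, j < n) ((i == j)%:R + (i == j.+1 :> nat)%:R).

(** The sum has at most one term; it is empty for the last column, which has no right neighbour. *)
Lemma mulmx_bidiag (R : nzRingType) (m n : nat) (A : 'M[R]_(m, n)) i j :
  (A *m bidiag_mx R n) i j = A i j + \sum_(k < n | k == j.+1 :> nat) A i k.
Proof.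
rewrite mxE; under eq_bigr => k _ do rewrite mxE mulrDr !mulr_natr !mulrb.
by rewrite big_split -!big_mkcond big_pred1_eq.
Qed.

Lemma map_bidiag_mx (R T : nzRingType) (f : {rmorphism R -> T}) n :
  map_mx f (bidiag_mx R n) = bidiag_mx T n.
Proof. by apply/matrixP => i j; rewrite !mxE rmorphD !rmorph_nat. Qed.

Lemma sum_ord_eq (V : nmodType) (n m : nat) (F : nat -> V) :
  \sum_(k < n | k == m :> nat) F k = if (m < n)%N then F m else 0.
Proof.
case: ltnP => [ltmn | lenm]; first by rewrite (big_pred1 (Ordinal ltmn)).
by rewrite big_pred0 // => k; apply: ltn_eqF; apply: leq_trans lenm.
Qed.

(** With N the subdiagonal shift, [sigmaW_mx] is the geometric series of -N and [bidiag_mx] is 1 +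
    N: below the diagonal, neighbouring entries of a row cancel. *)
Lemma sigmaW_mx_bidiag (K : fieldType) n :
  sigmaW_mx K n *m bidiag_mx K n = 1%:M.
Proof.
apply/matrixP => i j; rewrite mulmx_bidiag.
under eq_bigr => k _ do rewrite mxE.
rewrite (sum_ord_eq _ _ (fun k => if (k <= i)%N then (-1) ^+ (i - k) else 0)).
rewrite !mxE -val_eqE /=; case: (ltngtP j i) => [ji | ij | ->].
- by rewrite (leq_ltn_trans ji) // -(subnSK ji) exprS mulN1r addNr.
- by rewrite if_same addr0.
- by rewrite subnn if_same addr0.
Qed.

Lemma prime_dvd_fact p k : prime p -> (k < p)%N -> ~~ (p %| k`!)%N.
Proof.
move=> p_prime; elim: k => [|k IH] ltkp.
  by rewrite dvdn1 neq_ltn prime_gt1 ?orbT.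
by rewrite factS Euclid_dvdM // negb_or gtnNdvd // IH // ltnW.
Qed.

(** * Invariants and covariants of a cyclic group *)

Section Actions.

Variables (K : fieldType) (gT : finGroupType) (G : {group gT}) (m n : nat).
Variables (rX : mx_representation K G m) (rW : mx_representation K G n).

Lemma actSX g i : actS rX g 'X_i = \sum_(j < m) rX g i j *: 'X_j.
Proof. by rewrite /actS comp_mpolyXU -tnth_nth tnth_mktuple. Qed.

(** Matrices act on rows from the right, so [h] followed by [g] is the product [h * g]. *)
Lemma actS_comp g h f : g \in G -> h \in G ->
  actS rX g (actS rX h f) = actS rX (h * g)%g f.
Proof.
move=> Gg Gh; rewrite /actS comp_mpolyA; congr (_ \mPo _).
apply: eq_mktuple => i; rewrite tnth_mktuple raddf_sum /= repr_mxM //.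
under eq_bigr => j _ do
  rewrite comp_mpolyZ [X in _ *: X](actSX g j) scaler_sumr.
rewrite exchange_big /=; apply: eq_bigr => k _.
by rewrite mxE scaler_suml; apply: eq_bigr => j _; rewrite scalerA.
Qed.

HB.instance Definition _ g := GRing.RMorphism.copy (actS rX g)
  (comp_mpoly [tuple \sum_(j < m) rX g i j *: 'X_j | i < m]).

Lemma actSW_comp g h u : g \in G -> h \in G ->
  actSW rX rW g (actSW rX rW h u) = actSW rX rW (h * g)%g u.
Proof.
move=> Gg Gh; rewrite /actSW repr_mxM //.
have -> := @map_mxM _ _ (actS rX g).
have -> := @map_mxM _ _ (@mpolyC m K) _ _ _ (rW h) (rW g).
have -> : map_mx (actS rX g) (map_mx (actS rX h) u)
    = map_mx (actS rX (h * g)%g) u.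
  by apply/matrixP => i j; rewrite !mxE; apply: actS_comp.
(* Constant polynomials are unaffected by substitution. *)
have -> : map_mx (actS rX g) (map_mx (@mpolyC m K) (rW h))
    = map_mx (@mpolyC m K) (rW h).
  by apply/matrixP => i j; rewrite !mxE; apply: comp_mpolyC.
by rewrite mulmxA.
Qed.

Variable sigma : gT.
Hypothesis G_cyclic : G :=: <[sigma]>%g.

Lemma sigma_in_G : sigma \in G.
Proof. by rewrite G_cyclic cycle_id. Qed.

Lemma actS1 f : actS rX 1%g f = f.
Proof.
rewrite -[RHS]comp_mpoly_id /actS; congr (_ \mPo _); apply: eq_mktuple => i.
rewrite repr_mx1 (bigD1 i) //= mxE eqxx scale1r big1 ?addr0 // => j ji.
by rewrite mxE eq_sym (negPf ji) scale0r.
Qed.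

Lemma actSW1 u : actSW rX rW 1%g u = u.
Proof.
rewrite /actSW repr_mx1 map_mx1 mulmx1; apply/matrixP => i j.
by rewrite mxE actS1.
Qed.

Lemma invariants_cyclicP f :
  reflect (actS rX sigma f = f) (f \in invariants rX).
Proof.
apply: (iffP forall_inP) => [/(_ _ sigma_in_G)/eqP // | sf g].
rewrite G_cyclic => /cycleP[i ->]; apply/eqP.
elim: i => [|i IH]; first exact: actS1.
by rewrite expgSr -actS_comp ?groupX ?IH ?sigma_in_G.
Qed.

Lemma covariants_cyclicP u :
  reflect (actSW rX rW sigma u = u) (u \in covariants rX rW).
Proof.
apply: (iffP forall_inP) => [/(_ _ sigma_in_G)/eqP // | su g].
rewrite G_cyclic => /cycleP[i ->]; apply/eqP.
elim: i => [|i IH]; first exact: actSW1.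
by rewrite expgSr -actSW_comp ?groupX ?IH ?sigma_in_G.
Qed.

Lemma ThetaE f i : Theta n rX sigma f 0 i = iter i (Delta rX sigma) f.
Proof.
rewrite /Theta summxE (bigD1 i) //= big1 => [|j ji]; rewrite !mxE.
  by rewrite !eqxx mulr1 addr0.
by rewrite eq_sym (negPf ji) andbF mulr0.
Qed.

Lemma actSW_sigmaP u : rW sigma = sigmaW_mx K n ->
  actSW rX rW sigma u = u <->
  forall j, Delta rX sigma (u 0 j) = \sum_(k < n | k == j.+1 :> nat) u 0 k.
Proof.
move=> rW_sigma; rewrite /actSW rW_sigma.
set W := map_mx _ (sigmaW_mx _ _).
have WB : W *m bidiag_mx _ n = 1%:M.
  have := congr1 (map_mx (@mpolyC m K)) (sigmaW_mx_bidiag K n).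
  have -> := @map_mxM _ _ (@mpolyC m K) _ _ _ (sigmaW_mx K n) (bidiag_mx K n).
  have -> := map_bidiag_mx (@mpolyC m K) n.
  by have -> := map_mx1 (@mpolyC m K) n.
(* Moving the matrix of sigma to the other side replaces alternating sums by the local relation
   [s u_j = u_j + u_(j+1)]. *)
transitivity (map_mx (actS rX sigma) u = u *m bidiag_mx _ n).
  split=> [uW | ->]; first by rewrite -[in RHS]uW -mulmxA WB mulmx1.
  by rewrite -mulmxA (mulmx1C WB) mulmx1.
split=> [su j | Du].
  have /rowP/(_ j) := su; rewrite mulmx_bidiag mxE /Delta => ->.
  by rewrite addrC addKr.
apply/rowP => j; rewrite mulmx_bidiag mxE -Du /Delta.
by rewrite addrC subrK.
Qed.

Lemma Theta_covariant f : rW sigma = sigmaW_mx K n ->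
  f \in kerDelta rX sigma n -> Theta n rX sigma f \in covariants rX rW.
Proof.
move=> rW_sigma /eqP f0; apply/covariants_cyclicP/actSW_sigmaP => // j.
rewrite ThetaE; under eq_bigr => k _ do rewrite ThetaE.
rewrite (sum_ord_eq _ _ (fun k => iter k (Delta rX sigma) f)) -iterS.
(* At the last index the right side is 0, and the left side is the n-th difference of [f]. *)
by case: ltnP => // nj; rewrite -(_ : n = j.+1) //; apply/anti_leq/andP.
Qed.

Lemma covariant_Theta u (n_gt0 : (0 < n)%N) : rW sigma = sigmaW_mx K n ->
  u \in covariants rX rW ->
  exists2 f, f \in kerDelta rX sigma n & u = Theta n rX sigma f.
Proof.
move=> rW_sigma /covariants_cyclicP/(actSW_sigmaP _ rW_sigma) Du.
pose f := u 0 (Ordinal n_gt0).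
have uf j : u 0 j = iter j (Delta rX sigma) f.
  case: j; elim=> [|j IH] ltjn; first by congr (u 0 _); apply: val_inj.
  rewrite iterS -(IH (ltnW ltjn)) Du.
  by rewrite (big_pred1 (Ordinal ltjn)).
exists f; last by apply/rowP => j; rewrite ThetaE.
(* The n-th difference of [f] is [Delta] of the last coordinate of [u], whose relation has an empty
   sum. *)
apply/eqP; rewrite -(prednK n_gt0) iterS.
have ltn1 : (n.-1 < n)%N by rewrite prednK.
rewrite -(uf (Ordinal ltn1)) Du big_pred0 // => k /=.
by rewrite prednK // ltn_eqF.
Qed.

End Actions.

Theorem theorem9 (p : nat) (K : fieldType) (gT : finGroupType)
    (G : {group gT}) (sigma : gT) (n : nat)
    (p_prime : prime p) (charK : p \in [pchar K])
    (G_cyclic : G :=: <[sigma]>%g) (cardG : #|G| = p)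
    (n_gt0 : (0 < n)%N) (n_le_p : (n <= p)%N)
    (rX : mx_representation K G 2) (rX_sigma : rX sigma = sigmaX_mx K)
    (rW : mx_representation K G n) (rW_sigma : rW sigma = sigmaW_mx K n) :
  let x1 : {mpoly K[2]} := 'X_(0 : 'I_2) in
  [/\ forall k : 'I_n, x1 ^+ k \in kerDelta rX sigma n,
      freely_generates (invariants rX) (covariants rX rW)
        (fun k : 'I_n => Theta n rX sigma (x1 ^+ k))
    & Theta n rX sigma 1 = wbasis K 2 (Ordinal n_gt0)].
Proof.
move=> x; pose s : {rmorphism _ -> _} := actS rX sigma.
pose y : {mpoly K[2]} := 'X_(1 : 'I_2).
have sx : s x = x + y.
  rewrite /s /= /x actSX rX_sigma big_ord_recl big_ord1 !mxE !scale1r.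
  by congr (_ + 'X_ _); apply: val_inj.
have sy : s y = y.
  rewrite /s /= /y actSX rX_sigma big_ord_recl big_ord1 !mxE.
  rewrite scale0r add0r scale1r.
  by congr 'X_ _; apply: val_inj.
have y_neq0 : y != 0 by rewrite -msupp_eq0 msuppX.
(* On the variables the quotients are 1 for [x] and 0 for [y]. *)
have s_dvd f : exists g, diff s f = y * g.
  apply: comp_mpoly_sub_dvd => i.
  have -> : tnth [tuple \sum_(j < 2) rX sigma k j *: 'X_j | k < 2] i = s 'X_i.
    by rewrite tnth_mktuple /s /= actSX.
  case: (unliftP ord0 i) => [j|] ->; last first.
    by exists 1; rewrite sx mulr1 addrC addKr.
  exists 0; rewrite mulr0 (_ : 'X_ _ = y) ?sy ?subrr //.
  by congr 'X_ _; apply: val_inj; rewrite /= ord1.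
(* As [k < n <= p], the prime [p] does not divide the factorial, which is therefore a nonzero
   constant. *)
have fact_unit (k : 'I_n) : k`!%:R \is a @GRing.unit {mpoly K[2]}.
  rewrite -(rmorph_nat (@mpolyC 2 K)); apply: rmorph_unit; rewrite unitfE.
  rewrite -(dvdn_pcharf charK).
  exact: prime_dvd_fact p_prime (leq_trans (ltn_ord k) n_le_p).
have fact_neq0 (k : 'I_n) : k`!%:R != 0 :> {mpoly K[2]}.
  by apply: contraTneq (fact_unit k) => ->; rewrite unitr0.
have x_ker (k : 'I_n) : x ^+ k \in kerDelta rX sigma n.
  by apply/eqP/(iter_diff_expx_lt sx sy).
(* Linearity of [Theta] over the invariants transports both generation and freeness from the kernel
   of the n-th difference. *)
have Theta_sum (c : 'I_n -> {mpoly K[2]}) : (forall k, s (c k) = c k) ->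
    \sum_(k < n) c k *: Theta n rX sigma (x ^+ k)
    = Theta n rX sigma (\sum_(k < n) c k * x ^+ k).
  move=> sc; apply/rowP => j; rewrite summxE ThetaE.
  have -> := @iter_diff_sum _ s j n (fun k => c k * x ^+ k).
  apply: eq_bigr => k _; rewrite mxE ThetaE.
  by have -> := @iter_diffM _ s j (c k) (x ^+ k) (sc k).
split=> //.
  split=> [k | u | c cA].
  - exact: Theta_covariant.
  - move=> /(covariant_Theta G_cyclic n_gt0 rW_sigma)[f /eqP f0 ->].
    have [c sc fc] := expx_generates sx sy s_dvd y_neq0 fact_unit f0.
    exists c => [k|]; last by rewrite Theta_sum // -fc.
    by apply/(invariants_cyclicP _ G_cyclic); apply: sc.
  - have sc k : s (c k) = c k by apply/(invariants_cyclicP _ G_cyclic).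
    (* Coordinate 0 of [Theta] recovers its argument, so the relation becomes one among powers of
       [x]. *)
    rewrite Theta_sum // => /rowP/(_ (Ordinal n_gt0)); rewrite ThetaE mxE /=.
    exact: (expx_free sx sy y_neq0 fact_neq0 sc).
apply/rowP => j; rewrite ThetaE !mxE /=; case: j => -[|j] ltjn //=.
by have := iter_diff_expx_lt sx sy (ltn0Sn j); rewrite expr0.
Qed.
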